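(* Let $(E, \|\cdot\|_E, \tau)$ be a truncated normed Riesz space. Then its canonical unitization $E \oplus \mathbb{R}$ is not an $AL$-space under any truncation unitization norm.
   Context: All Riesz spaces are real. A truncation on a Riesz space $E$ is a map $\tau : E^{+} \to E^{+}$ such that $\tau(f) \wedge g = f \wedge \tau(g)$ for all $f, g \in E^{+}$; put $[\tau] = \{f \in E^{+} : \tau(f) = f\}$. A truncated normed Riesz space is a triple $(E, \|\cdot\|_E, \tau)$ where $E$ is a Riesz space, $\|\cdot\|_E$ is a lattice norm on $E$, and $\tau$ is a truncation on $E$ such that $\tau(f)=0$ implies $f=0$, and $\sup\{\|\tau(f)\|_E : f \in E^{+}\} = 1$. The canonical (Alexandroff) unitization $E \oplus \mathbb{R}$ is the direct sum vector space (elements written $x + r$ with $x \in E$, $r \in \mathbb{R}$), which is a Riesz space under the positive cone $$(E \oplus \mathbb{R})^{+} = E^{+} \cup \Big\{ x + \lambda : 0 < \lambda \in \mathbb{R},\ x \in E,\ \tfrac{1}{\lambda} x^{-} \in [\tau] \Big\};$$ it contains $E$ as an ideal. Write $\mathbf{1} := 0 + 1 \in E \oplus \mathbb{R}$. A truncation unitization norm on $E \oplus \mathbb{R}$ is a lattice norm $\|\cdot\|_U$ on $E \oplus \mathbb{R}$ such that $\|\mathbf 1\|_U = 1$ and $\|x\|_U = \|x\|_E$ for every $x \in E$. An $AL$-space is a Banach lattice whose norm satisfies $\|x+y\| = \|x\|+\|y\|$ whenever $x \wedge y = 0$. *)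

(* Defs.v *)
From HB Require Import structures.
From mathcomp Require Import all_boot all_order all_algebra.
From mathcomp Require Import all_classical all_reals all_analysis.

Set Implicit Arguments.
Unset Strict Implicit.
Unset Printing Implicit Defensive.

Import Order.TTheory GRing.Theory Num.Theory.
Import numFieldNormedType.Exports.

Local Open Scope ring_scope.

(* The order is carried by the mixin instead of being inherited from
   [latticeType]: a structure joining [lmodType] and [latticeType] cannot be
   declared on top of the existing hierarchy ([realDomainType] would have to
   inherit from it).  The lattice instances below give every [rieszType] the
   usual order notations and lemmas. *)
HB.mixin Record Lmodule_isRiesz (R : numDomainType) E & GRing.Lmodule R E := {
  rle : rel E ;
  rmeet : E -> E -> E ;
  rjoin : E -> E -> E ;
  rle_refl : reflexive rle ;
  rle_anti : antisymmetric rle ;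
  rle_trans : transitive rle ;
  rle_meet : forall x y z, rle x (rmeet y z) = rle x y && rle x z ;
  rjoin_le : forall x y z, rle (rjoin x y) z = rle x z && rle y z ;
  rle_add : forall z x y, rle x y -> rle (z + x) (z + y) ;
  rle_scale : forall (a : R) x, 0 <= a -> rle 0 x -> rle 0 (a *: x)
}.

#[short(type="rieszType")]
HB.structure Definition Riesz (R : numDomainType) :=
  { E of GRing.Lmodule R E & Lmodule_isRiesz R E }.

HB.instance Definition _ (R : numDomainType) (E : rieszType R) :=
  Order.Le_isPOrder.Build ring_display (Riesz.sort E)
    (@rle_refl R E) (@rle_anti R E) (@rle_trans R E).
HB.instance Definition _ (R : numDomainType) (E : rieszType R) :=
  Order.POrder_MeetJoin_isLattice.Build ring_display (Riesz.sort E)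
    (@rle_meet R E) (@rjoin_le R E).

Definition rneg (R : numDomainType) (E : rieszType R) (x : E) : E :=
  (- x `|` 0)%O.
Definition rabs (R : numDomainType) (E : rieszType R) (x : E) : E :=
  (x `|` - x)%O.

Section RieszTheory.
Variables (R : numFieldType) (E : rieszType R).
Implicit Types (x y z t : E) (a b : R).

Lemma rleD2l z x y : (z + x <= z + y) = (x <= y).
Proof.
apply/idP/idP => [h|]; last exact: rle_add.
by have := rle_add (- z) _ _ h; rewrite !addKr.
Qed.

Lemma rleD2r z x y : (x + z <= y + z) = (x <= y).
Proof. by rewrite ![_ + z]addrC rleD2l. Qed.

Lemma rsub_ge0 x y : (0 <= y - x) = (x <= y).
Proof. by rewrite -(rleD2r x 0 (y - x)) add0r subrK. Qed.

Lemma rleN2 x y : (- x <= - y) = (y <= x).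
Proof. by rewrite -(rsub_ge0 (- x)) opprK addrC rsub_ge0. Qed.

Lemma rleD x y z t : x <= y -> z <= t -> x + z <= y + t.
Proof.
move=> h k; apply: (@le_trans _ _ (y + z)); first by rewrite rleD2r.
by rewrite rleD2l.
Qed.

Lemma rleBlDr x y z : (x - y <= z) = (x <= z + y).
Proof. by rewrite -(rleD2r y (x - y)) subrK. Qed.

Lemma rleBrDr x y z : (x <= z - y) = (x + y <= z).
Proof. by rewrite -(rleD2r y x (z - y)) subrK. Qed.

Lemma raddr_ge0 x y : 0 <= x -> 0 <= y -> 0 <= x + y.
Proof. by move=> h k; rewrite -[0]addr0; apply: rleD. Qed.

Lemma rscale_ge0 a x : 0 <= a -> 0 <= x -> 0 <= a *: x.
Proof. exact: rle_scale. Qed.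

Lemma rscale_le a x y : 0 <= a -> x <= y -> a *: x <= a *: y.
Proof. by move=> a0 h; rewrite -rsub_ge0 -scalerBr rscale_ge0 ?rsub_ge0. Qed.

Lemma rscale_le2 a b x : a <= b -> 0 <= x -> a *: x <= b *: x.
Proof. by move=> h x0; rewrite -rsub_ge0 -scalerBl rscale_ge0 ?subr_ge0. Qed.

Lemma rmeetDr x y z : ((x + z) `&` (y + z))%O = (x `&` y)%O + z.
Proof.
apply: le_anti; apply/andP; split.
  by rewrite -rleBlDr lexI !rleBlDr leIl leIr.
by rewrite lexI !rleD2r leIl leIr.
Qed.

Lemma rneg_ge0 x : 0 <= rneg x. Proof. exact: leUr. Qed.

Lemma rnegE x : rneg x = - ((0 : E) `&` x)%O.
Proof.
apply: le_anti; apply/andP; split.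
  by rewrite leUx -{2}oppr0 !rleN2 leIl leIr.
rewrite -[rneg x]opprK rleN2 lexI; apply/andP; split.
  by rewrite -oppr0 rleN2 rneg_ge0.
by rewrite -[leRHS]opprK rleN2 leUl.
Qed.

Lemma rneg_disj x : (rneg x `&` (x + rneg x))%O = 0.
Proof. by rewrite -{1}[rneg x]add0r rmeetDr rnegE addrN. Qed.

Lemma rneg_le0 x : 0 <= x -> rneg x = 0.
Proof. by move=> h; rewrite rnegE (meet_idPl h) oppr0. Qed.

Lemma rneg_eq0 x : (rneg x == 0) = (0 <= x).
Proof.
apply/eqP/idP => [h|]; last exact: rneg_le0.
by rewrite -[x]opprK -oppr0 rleN2 -h leUl.
Qed.

Lemma rneg_leP x y : 0 <= y -> (rneg x <= y) = (0 <= x + y).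
Proof. by move=> h; rewrite leUx h andbT -rsub_ge0 opprK addrC. Qed.

Lemma raddr_rneg_ge0 x : 0 <= x + rneg x.
Proof. by rewrite -rneg_leP // rneg_ge0. Qed.

End RieszTheory.

(* A map E^+ -> E^+ is a total function on E of which only the values on the
   positive cone are constrained and used. *)
Record truncation (R : numDomainType) (E : rieszType R) := Truncation {
  trunc_fun :> E -> E ;
  trunc_ge0 : forall f, 0 <= f -> 0 <= trunc_fun f ;
  truncP : forall f g, 0 <= f -> 0 <= g ->
    (trunc_fun f `&` g)%O = (f `&` trunc_fun g)%O
}.

Definition tfixed (R : numDomainType) (E : rieszType R) (tau : truncation E)
  : pred E := [pred f | (0 <= f) && (tau f == f)].

Definition unitization (R : numFieldType) (E : rieszType R)
  (tau : truncation E) : Type := (E * R^o)%type.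

HB.instance Definition _ (R : numFieldType) (E : rieszType R)
  (tau : truncation E) :=
  GRing.Lmodule.copy (unitization tau) (E * R^o)%type.

Definition uembed (R : numFieldType) (E : rieszType R) (tau : truncation E)
  (x : E) : unitization tau := (x, 0).
Definition uone (R : numFieldType) (E : rieszType R) (tau : truncation E)
  : unitization tau := (0, 1).

Definition ucone (R : numFieldType) (E : rieszType R) (tau : truncation E)
  : pred (unitization tau) :=
  [pred u | (u.2 == 0) && (0 <= u.1)
         || (0 < u.2) && (u.2^-1 *: rneg u.1 \in tfixed tau)].

Section UnitizationOrder.
Variables (R : realFieldType) (E : rieszType R) (tau : truncation E).
Implicit Types (f g h x y : E) (r s : R) (u v w : unitization tau).

Lemma trunc_le f : 0 <= f -> tau f <= f.
Proof.
move=> f0; have t0 := trunc_ge0 tau f0.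
have := truncP tau t0 f0; rewrite meetxx => e.
by rewrite -[leLHS]e leIr.
Qed.

Lemma trunc_tfixed f : 0 <= f -> tau f \in tfixed tau.
Proof.
move=> f0; have t0 := trunc_ge0 tau f0.
rewrite inE t0 /=; apply/eqP/le_anti; rewrite trunc_le //=.
by have := truncP tau t0 f0; rewrite meetxx => e; rewrite -[leLHS]e leIl.
Qed.

Lemma tfixed_le_trunc f g : 0 <= f -> g \in tfixed tau -> g <= f -> g <= tau f.
Proof.
move=> f0; rewrite inE => /andP[g0 /eqP gE] gf.
have := truncP tau f0 g0; rewrite gE (meet_idPr gf) => e.
by rewrite -[leLHS]e leIl.
Qed.

Lemma tfixed_solid f g : f \in tfixed tau -> 0 <= g -> g <= f ->
  g \in tfixed tau.
Proof.
rewrite !inE => /andP[f0 /eqP fE] g0 gf; rewrite g0 /=.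
apply/eqP/le_anti; rewrite trunc_le //=.
have := truncP tau g0 f0; rewrite fE (meet_idPl gf) => e.
by rewrite -[leLHS]e leIl.
Qed.

Lemma tfixed_join f g : f \in tfixed tau -> g \in tfixed tau ->
  (f `|` g)%O \in tfixed tau.
Proof.
move=> fT gT; have f0 : 0 <= f by case/andP: fT.
have j0 : 0 <= (f `|` g)%O by rewrite (le_trans f0) ?leUl.
rewrite inE j0 /=; apply/eqP/le_anti; rewrite trunc_le //= leUx.
by rewrite !tfixed_le_trunc ?leUl ?leUr.
Qed.

(* For 0 <= r, [level r f] says that 0 <= f <= r *: 1 in the unitization. *)
Definition level r f :=
  if r == 0 then f == 0 else r^-1 *: f \in tfixed tau.

Definition cut r f : E := if r == 0 then 0 else r *: tau (r^-1 *: f).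

Lemma uconeE u : ucone u = (0 <= u.2) && level u.2 (rneg u.1).
Proof.
rewrite /ucone /level /=; case: (@eqP _ u.2) => [-> |/eqP r0].
  by rewrite ltxx lexx rneg_eq0 orbF.
by rewrite /= lt_neqAle eq_sym r0.
Qed.

Lemma level_ge0 r f : 0 <= r -> level r f -> 0 <= f.
Proof.
move=> r0; rewrite /level; case: eqP => [_ /eqP -> //|/eqP rn].
rewrite inE => /andP[h _].
by rewrite -[f]scale1r -(mulfV rn) -scalerA rscale_ge0.
Qed.

Lemma level0 r : level r 0.
Proof.
rewrite /level scaler0; case: eqP => // _.
by apply: (tfixed_solid (trunc_tfixed (lexx 0))); rewrite ?trunc_ge0.
Qed.

Lemma level_solid r f g : 0 <= r -> level r f -> 0 <= g -> g <= f -> level r g.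
Proof.
move=> r0; rewrite /level; case: eqP => [_ /eqP -> g0 g1|/eqP rn h g0 gf].
  by rewrite eq_le g0 g1.
have ri : 0 <= r^-1 by rewrite invr_ge0.
by apply: tfixed_solid h _ _; rewrite ?rscale_ge0 ?rscale_le.
Qed.

Lemma level_join r f g : 0 <= r -> level r f -> level r g ->
  level r (f `|` g)%O.
Proof.
move=> r0 fr gr.
have f0 := level_ge0 r0 fr; have g0 := level_ge0 r0 gr.
move: fr gr; rewrite /level; case: eqP => [_ /eqP -> /eqP ->|/eqP rn h k].
  by rewrite joinxx.
have ri : 0 <= r^-1 by rewrite invr_ge0.
apply: tfixed_solid (tfixed_join h k) _ _.
  by rewrite rscale_ge0 // (le_trans f0) ?leUl.
set m := (r^-1 *: f `|` r^-1 *: g)%O.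
suff H : (f `|` g)%O <= r *: m.
  by rewrite -[m]scale1r -(mulVf rn) -scalerA rscale_le.
by rewrite leUx -[f]scale1r -[g]scale1r -(mulfV rn) -!scalerA !rscale_le
  ?leUl ?leUr.
Qed.

Lemma level_scale r a f : 0 <= a -> level r f -> level (a * r) (a *: f).
Proof.
rewrite le_eqVlt => /predU1P[<- _|a0]; first by rewrite scale0r level0.
rewrite /level mulf_eq0 (gt_eqF a0) /=.
case: (@eqP _ r) => [_ /eqP ->|/eqP rn]; first by rewrite scaler0.
by rewrite scalerA invfM mulrAC mulVf ?mul1r // gt_eqF.
Qed.

Lemma level_add r s f g : 0 <= r -> 0 <= s -> level r f -> level s g ->
  level (r + s) (f + g).
Proof.
rewrite le_eqVlt => /predU1P[<- _|r0].
  by rewrite {1}/level eqxx add0r => /eqP ->; rewrite add0r.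
rewrite le_eqVlt => /predU1P[<- h|s0 fr gs].
  by rewrite {1}/level eqxx addr0 => /eqP ->; rewrite addr0.
have rs0 : 0 < r + s by rewrite addr_gt0.
have f0 := level_ge0 (ltW r0) fr; have g0 := level_ge0 (ltW s0) gs.
have rsn : r + s != 0 by rewrite gt_eqF.
have f1 : level (r + s) (((r + s) / r) *: f).
  by have := level_scale (ltW (divr_gt0 rs0 r0)) fr; rewrite divfK ?gt_eqF.
have g1 : level (r + s) (((r + s) / s) *: g).
  by have := level_scale (ltW (divr_gt0 rs0 s0)) gs; rewrite divfK ?gt_eqF.
apply: level_solid (ltW rs0) (level_join (ltW rs0) f1 g1) _ _.
  exact: raddr_ge0.
set m := (((r + s) / r) *: f `|` ((r + s) / s) *: g)%O.
have fm : f <= (r / (r + s)) *: m.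
  have -> : f = (r / (r + s)) *: (((r + s) / r) *: f).
    by rewrite scalerA mulrA divfK // mulfV ?scale1r ?gt_eqF.
  rewrite rscale_le ?leUl //; first by rewrite divr_ge0 // ltW.
have gm : g <= (s / (r + s)) *: m.
  have -> : g = (s / (r + s)) *: (((r + s) / s) *: g).
    by rewrite scalerA mulrA divfK // mulfV ?scale1r ?gt_eqF.
  rewrite rscale_le ?leUr //; first by rewrite divr_ge0 // ltW.
apply: le_trans (rleD fm gm) _.
by rewrite -scalerDl -mulrDl mulfV // scale1r.
Qed.

Lemma level_cut r f : 0 <= r -> 0 <= f -> level r (cut r f).
Proof.
move=> r0 f0; rewrite /level /cut; case: eqP => // /eqP rn.
by rewrite scalerA mulVf // scale1r trunc_tfixed // rscale_ge0 // invr_ge0.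
Qed.

Lemma cut_le r f : 0 <= r -> 0 <= f -> cut r f <= f.
Proof.
move=> r0 f0; rewrite /cut; case: eqP => // /eqP rn.
rewrite -[leRHS]scale1r -(mulfV rn) -scalerA rscale_le // trunc_le //.
by rewrite rscale_ge0 // invr_ge0.
Qed.

Lemma le_cut r f g : 0 <= r -> 0 <= f -> level r g -> g <= f -> g <= cut r f.
Proof.
move=> r0 f0; rewrite /level /cut; case: eqP => [_ /eqP -> //|/eqP rn h gf].
rewrite -[leLHS]scale1r -(mulfV rn) -scalerA rscale_le //.
have ri : 0 <= r^-1 by rewrite invr_ge0.
by rewrite tfixed_le_trunc ?rscale_ge0 ?rscale_le.
Qed.

Lemma level_sub_cut r s f : 0 <= r -> r <= s -> level s f ->
  level (s - r) (f - cut r f).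
Proof.
move=> r0 rs fs; have s0 := le_trans r0 rs; have f0 := level_ge0 s0 fs.
have c0 : 0 <= f - cut r f by rewrite rsub_ge0 cut_le.
have sr0 : 0 <= s - r by rewrite subr_ge0.
have [rE|rn] := eqVneq r 0; first by rewrite /cut rE eqxx !subr0.
have sp : 0 < s by apply: lt_le_trans rs; rewrite lt_neqAle eq_sym rn.
have sn : s != 0 by rewrite gt_eqF.
have q0 : 0 <= 1 - r / s by rewrite subr_ge0 ler_pdivrMr ?mul1r.
have := level_scale q0 fs; rewrite mulrBl mul1r divfK // => h.
apply: level_solid sr0 h c0 _.
rewrite scalerBl scale1r rleD2l rleN2; apply: le_cut => //.
  by have := level_scale (divr_ge0 r0 s0) fs; rewrite divfK.
rewrite -[leRHS]scale1r rscale_le2 //.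
by rewrite ler_pdivrMr ?mul1r.
Qed.

Lemma uconeP u :
  ucone u <-> 0 <= u.2 /\ exists2 f, level u.2 f & 0 <= u.1 + f.
Proof.
rewrite uconeE; split=> [/andP[u0 h]|[u0 [f h uf]]].
  by split=> //; exists (rneg u.1); rewrite // raddr_rneg_ge0.
rewrite u0 /=; apply: (level_solid u0 h (rneg_ge0 _)).
by rewrite rneg_leP ?(level_ge0 u0 h).
Qed.

Lemma ucone0 : ucone (0 : unitization tau).
Proof. by apply/uconeP; split=> //; exists 0; rewrite ?level0 // addr0. Qed.

Lemma ucone_add u v : ucone u -> ucone v -> ucone (u + v).
Proof.
move=> /uconeP[u0 [f fu uf]] /uconeP[v0 [g gv vg]].
apply/uconeP; split; first exact: addr_ge0.
exists (f + g); first exact: level_add.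
by rewrite [X in X + _](_ : _ = u.1 + v.1) // addrACA raddr_ge0.
Qed.

Lemma ucone_scale (a : R) u : 0 <= a -> ucone u -> ucone (a *: u).
Proof.
move=> a0 /uconeP[u0 [f fu uf]]; apply/uconeP; split; first exact: mulr_ge0.
exists (a *: f); first exact: level_scale.
by rewrite [X in X + _](_ : _ = a *: u.1) // -scalerDr rscale_ge0.
Qed.

Lemma ucone_anti u : ucone u -> ucone (- u) -> u = 0.
Proof.
move=> /uconeP[u0 [f fu uf]] /uconeP[v0 [g gv vg]].
have u2 : u.2 = 0 by apply: le_anti; rewrite u0 andbT -oppr_ge0.
have -> : u = (u.1, u.2) by case: (u).
move: fu gv; rewrite [(- u).2](_ : _ = - u.2) // u2 oppr0 /level eqxx.
move=> /eqP f0 /eqP g0; move: uf vg; rewrite f0 g0 !addr0.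
rewrite [(- u).1](_ : _ = - u.1) // => h k.
suff -> : u.1 = 0 by [].
by apply: le_anti; rewrite h andbT -rleN2 oppr0.
Qed.

(* Positive part of x + r.  For 0 <= r it is x^+ - (r *: 1 /\ x^-) + r, where
   r *: 1 /\ x^- is [cut r x^-]; for r < 0 it is u + (- u)^+. *)
Definition upos_nneg u : unitization tau :=
  (u.1 + rneg u.1 - cut u.2 (rneg u.1), u.2).

Definition upos u : unitization tau :=
  if 0 <= u.2 then upos_nneg u else u + upos_nneg (- u).

Lemma upos_nneg_cone u : 0 <= u.2 -> ucone (upos_nneg u).
Proof.
move=> u0; apply/uconeP; split=> //.
exists (cut u.2 (rneg u.1)); first by rewrite level_cut ?rneg_ge0.
by rewrite subrK raddr_rneg_ge0.
Qed.

Lemma upos_nneg_ge u : 0 <= u.2 -> ucone (upos_nneg u - u).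
Proof.
move=> u0; apply/uconeP.
have e2 : (upos_nneg u - u).2 = 0 by exact: subrr.
have e1 : (upos_nneg u - u).1 = rneg u.1 - cut u.2 (rneg u.1).
  rewrite [LHS](_ : _ = u.1 + rneg u.1 - cut u.2 (rneg u.1) - u.1) //.
  by rewrite addrAC [u.1 + _]addrC addrK.
rewrite e1 e2; split=> //; exists 0; first exact: level0.
by rewrite addr0 rsub_ge0 cut_le ?rneg_ge0.
Qed.

Lemma upos_nneg_lub u w : 0 <= u.2 -> ucone w -> ucone (w - u) ->
  ucone (w - upos_nneg u).
Proof.
case: u w => [x r] [y s] /= r0 /uconeP[/= s0 [h hs yh]] /uconeP.
rewrite [(_ - _).2](_ : _ = s - r) // [(_ - _).1](_ : _ = y - x) //.
move=> [sr0 [g gs yxg]]; have rs : r <= s by rewrite -subr_ge0.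
have h0 := level_ge0 s0 hs.
pose n := rneg x; have n0 : 0 <= n := rneg_ge0 x.
pose p := x + n; pose c := cut r n; pose d := cut r h.
have dr : level r d := level_cut r0 h0.
have d0 : 0 <= d := level_ge0 r0 dr.
pose k := (g `|` (h - d))%O; pose a := p - c - y.
apply/uconeP.
rewrite [(_ - _).2](_ : _ = s - r) // [(_ - _).1](_ : _ = y - (p - c)) //.
split=> //; exists k; first by rewrite level_join // level_sub_cut.
suff ak : a <= k.
  by rewrite addrAC rsub_ge0 [y + k]addrC -rleBlDr.
have ag : a - g <= n - c.
  rewrite !rleBlDr -[n - c + g + y]addrA addrAC subrK [p]addrC rleD2l.
  by rewrite -(rsub_ge0 x) -addrA addrC.
have ah : a - (h - d) <= p + d - c.
  rewrite rleBlDr addrAC -[p + d + _]addrA [d + _]addrC subrK addrAC rleD2l.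
  by rewrite -(rsub_ge0 (- y)) opprK addrC.
have nc : (n `&` (p + d))%O <= c.
  set m := (n `&` _)%O.
  have mn : m <= n by exact: leIl.
  have md : m <= d.
    rewrite -[d]add0r -rleBlDr -(rneg_disj x) lexI !rleBlDr leIr andbT.
    by rewrite (le_trans mn) // -{1}[n]addr0 rleD2l.
  apply: (@le_trans _ _ (n `&` d)%O); first by rewrite lexI mn.
  by rewrite le_cut ?leIl // (level_solid r0 dr) ?lexI ?n0 // leIr.
have : a - k <= ((n - c) `&` (p + d - c))%O.
  rewrite lexI; apply/andP; split.
    by apply: le_trans ag; rewrite rleD2l rleN2 leUl.
  by apply: le_trans ah; rewrite rleD2l rleN2 leUr.
rewrite rmeetDr => /le_trans ak.
have : a - k <= 0 by apply: ak; rewrite rleBlDr add0r.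
by rewrite rleBlDr add0r.
Qed.

Lemma upos_cone u : ucone (upos u).
Proof.
rewrite /upos; case: ifPn => [|]; first exact: upos_nneg_cone.
rewrite -ltNge => u0; have := @upos_nneg_ge (- u); rewrite opprK addrC; apply.
by rewrite [(- u).2](_ : _ = - u.2) // oppr_ge0 ltW.
Qed.

Lemma upos_ge u : ucone (upos u - u).
Proof.
rewrite /upos; case: ifPn => [|]; first exact: upos_nneg_ge.
rewrite -ltNge => u0; rewrite addrAC subrr add0r upos_nneg_cone //.
by rewrite [(- u).2](_ : _ = - u.2) // oppr_ge0 ltW.
Qed.

Lemma upos_lub u w : ucone w -> ucone (w - u) -> ucone (w - upos u).
Proof.
rewrite /upos; case: ifPn => [|]; first exact: upos_nneg_lub.
rewrite -ltNge => u0 w0 wu; rewrite opprD addrA upos_nneg_lub //.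
  by rewrite [(- u).2](_ : _ = - u.2) // oppr_ge0 ltW.
by rewrite opprK subrK.
Qed.

Definition ule u v := ucone (v - u).
Definition ujoin u v := u + upos (v - u).
Definition umeet u v := - ujoin (- u) (- v).

Lemma ule_refl : reflexive ule.
Proof. by move=> u; rewrite /ule subrr ucone0. Qed.

Lemma ule_anti : antisymmetric ule.
Proof.
move=> u v /andP[uv vu]; apply/esym/eqP; rewrite -subr_eq0; apply/eqP.
by apply: ucone_anti; rewrite ?opprB.
Qed.

Lemma ule_trans : transitive ule.
Proof. by move=> v u w uv vw; rewrite /ule -(subrK v w) -addrA ucone_add. Qed.

Lemma ujoin_le u v w : ule (ujoin u v) w = ule u w && ule v w.
Proof.
apply/idP/andP => [h|[uw vw]].
  split; apply: ule_trans h; rewrite /ule /ujoin.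
    by rewrite addrAC subrr add0r upos_cone.
  by have := upos_ge (v - u); rewrite opprB addrA [_ + u]addrC.
rewrite /ule /ujoin opprD addrA upos_lub //.
by rewrite opprB addrA subrK.
Qed.

Lemma ule_opp u v : ule (- u) (- v) = ule v u.
Proof. by rewrite /ule opprK addrC. Qed.

Lemma ule_meet u v w : ule u (umeet v w) = ule u v && ule u w.
Proof.
by rewrite /umeet -{1}[u]opprK ule_opp ujoin_le !ule_opp.
Qed.

Lemma ule_add w u v : ule u v -> ule (w + u) (w + v).
Proof. by rewrite /ule opprD addrACA subrr add0r. Qed.

Lemma ule_scale (a : R) u : 0 <= a -> ule 0 u -> ule 0 (a *: u).
Proof. by rewrite /ule !subr0; exact: ucone_scale. Qed.

HB.instance Definition _ := Lmodule_isRiesz.Build R (unitization tau)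
  ule_refl ule_anti ule_trans ule_meet ujoin_le ule_add ule_scale.
End UnitizationOrder.

HB.instance Definition _ (R : realFieldType) (E : rieszType R)
  (tau : truncation E) :=
  Order.Lattice.copy (unitization tau) (unitization tau : rieszType R).

(* The join and meet above are determined by the order, which is the one of
   the positive cone. *)
Lemma unitization_ge0 (R : realFieldType) (E : rieszType R)
  (tau : truncation E) (u : unitization tau) : (0 <= u) = ucone u.
Proof. by rewrite -[in RHS](subr0 u). Qed.

Record latticeNorm (R : numDomainType) (E : rieszType R) := LatticeNorm {
  lnorm :> E -> R ;
  lnormD : forall x y, lnorm (x + y) <= lnorm x + lnorm y ;
  lnormZ : forall (a : R) x, lnorm (a *: x) = `|a| * lnorm x ;
  lnorm0_eq0 : forall x, lnorm x = 0 -> x = 0 ;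
  lnorm_mono : forall x y, rabs x <= rabs y -> lnorm x <= lnorm y
}.

(* A Riesz space viewed as a normed module under one of its lattice norms. *)
Definition normed_by (R : realFieldType) (E : rieszType R)
  (N : latticeNorm E) : Type := E.
HB.instance Definition _ (R : realFieldType) (E : rieszType R)
  (N : latticeNorm E) := GRing.Lmodule.copy (normed_by N) E.
HB.instance Definition _ (R : realFieldType) (E : rieszType R)
  (N : latticeNorm E) :=
  Lmodule_isNormed.Build R (normed_by N)
    (lnormD N) (lnormZ N) (@lnorm0_eq0 _ _ N).

Definition banach_lattice (R : realFieldType) (E : rieszType R)
  (N : latticeNorm E) : Prop :=
  forall F : set_system (normed_by N), ProperFilter F -> cauchy F -> cvg F.

Definition AL_space (R : realFieldType) (E : rieszType R)
  (N : latticeNorm E) : Prop :=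
  banach_lattice N /\
  forall x y : E, (x `&` y)%O = 0 -> N (x + y) = N x + N y.

(* [sup] is 0 on sets with no supremum, so the last clause also says that the
   set is bounded above. *)
Definition truncated_normed (R : realType) (E : rieszType R)
  (N : latticeNorm E) (tau : truncation E) : Prop :=
  (forall f : E, 0 <= f -> tau f = 0 -> f = 0) /\
  sup [set N (tau f) | f in [set f : E | 0 <= f]] = 1.

Definition truncation_unitization_norm (R : realFieldType) (E : rieszType R)
  (N : latticeNorm E) (tau : truncation E)
  (U : latticeNorm (unitization tau)) : Prop :=
  U (uone tau) = 1 /\ forall x : E, U (uembed tau x) = N x.

(* Main.v *)
Require Import Defs.
From mathcomp Require Import all_boot all_order all_algebra.
From mathcomp Require Import all_classical all_reals all_analysis.
From mathcomp Require Import lra.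
From HB Require Import structures.

(** A truncation unitization norm that makes the unitization an AL-space keeps
    the fixed elements of [tau] uniformly away from norm 1, which contradicts
    [sup ||tau f|| = 1].

    The scalar part [pi (x + r) = r] is a positive functional, because every
    element of the positive cone has a nonnegative scalar part.  Positive
    functionals on a Banach lattice are bounded
    ([positive_functional_bounded]), so there is [c > 0] such that every
    [u >= 0] with [pi u = 1] has norm at least [c].

    Let [0 <= t <= 1] with [t] in E, and split [w = 1 - 2 t] into its disjoint
    parts [p = w^+] and [q = w^-].  Since [0 <= q <= t], the element [q] has
    scalar part 0; hence [p = w + q] has scalar part 1 and [||p|| >= c].  Also
    [p + q <= 1], so additivity of the norm on disjoint elements yields
    [||q|| <= 1 - c], and [2 t <= 1 + q] yields [||t|| <= 1 - c / 2]. *)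

Set Implicit Arguments.
Unset Strict Implicit.
Unset Printing Implicit Defensive.

Import Order.TTheory GRing.Theory Num.Theory.
Import numFieldNormedType.Exports.

Local Open Scope classical_set_scope.
Local Open Scope ring_scope.

Section LatticeNorm.
Variables (R : realFieldType) (E : rieszType R) (N : latticeNorm E).
Implicit Types x y : E.

Lemma ger0_rabs x : 0 <= x -> rabs x = x.
Proof.
by move=> x0; apply/join_idPl; rewrite (le_trans _ x0) // -oppr0 rleN2.
Qed.

Lemma lnorm_le x y : 0 <= x -> x <= y -> N x <= N y.
Proof.
by move=> x0 xy; apply: lnorm_mono; rewrite !ger0_rabs // (le_trans x0).
Qed.

Lemma lnorm_ge0 x : 0 <= N x.
Proof. exact: (normr_ge0 (x : normed_by N)). Qed.

Lemma lnorm0 : N 0 = 0.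
Proof. exact: (normr0 (normed_by N)). Qed.

Lemma rneg_le_rabs x : rneg x <= rabs x.
Proof.
rewrite leUx leUr /=.
(* |x| + |x| >= x + (- x) = 0. *)
have h : 0 <= 2%:R *: rabs x.
  by rewrite scaler_nat mulr2n -(subrr x) rleD ?leUl ?leUr.
have := @rscale_ge0 _ _ (2%:R^-1) _ _ h.
by rewrite scalerA mulVf ?pnatr_eq0 // scale1r; apply; rewrite invr_ge0.
Qed.

Lemma lnorm_rneg_le x : N (rneg x) <= N x.
Proof.
apply: lnorm_mono; rewrite ger0_rabs ?rneg_ge0 //; exact: rneg_le_rabs.
Qed.

Lemma rneg_anti x y : x <= y -> rneg y <= rneg x.
Proof.
by move=> xy; rewrite leUx leUr andbT (le_trans _ (leUl _ _)) // rleN2.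
Qed.

End LatticeNorm.

(** The negative part of [l - s n] is at most that of [l - s m] for [m >= n],
    so its norm is arbitrarily small. *)
Lemma cvg_nondecreasing_le (R : realFieldType) (E : rieszType R)
  (N : latticeNorm E) (s : nat -> normed_by N) (l : normed_by N) n :
  (forall i j, (i <= j)%N -> (s i : E) <= s j) ->
  s @ \oo --> l -> (s n : E) <= l.
Proof.
move=> sm sl; rewrite -rsub_ge0 -rneg_eq0; apply/eqP/(lnorm0_eq0 (l := N)).
apply/le_anti/andP; split; last exact: lnorm_ge0.
apply/ler_addgt0Pl => e e0; rewrite addr0.
have /cvgrPdist_lt/(_ e e0)[M _ hM] := sl.
have := hM (maxn M n) (leq_maxl _ _) => /ltW; apply: le_trans.
apply: le_trans (lnorm_rneg_le N _).
apply: lnorm_le; first exact: rneg_ge0.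
by apply: rneg_anti; rewrite rleD2l rleN2 sm // leq_maxr.
Qed.

(** The geometric bound on the terms makes the partial sums a Cauchy
    sequence, which converges by completeness. *)
Lemma banach_lattice_series (R : realType) (E : rieszType R)
  (N : latticeNorm E) (u : nat -> E) :
  banach_lattice N -> (forall n, N (u n) <= 2^-1 ^+ n) ->
  exists l : normed_by N,
    (fun n => \sum_(i < n) u i : normed_by N) @ \oo --> l.
Proof.
move=> hB hu; pose s n : normed_by N := \sum_(i < n) u i.
suff [l sl] : exists l : normed_by N, s @ \oo --> l by exists l.
(* 2 * 2^-n is the full tail of the geometric series from index n, so the
   bound telescopes in k. *)
have tail n k :
    N (s (n + k)%N - s n : E) <= 2 * 2^-1 ^+ n - 2 * 2^-1 ^+ (n + k).
  elim: k => [|k IH].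
    by rewrite addn0 !subrr lnorm0.
  rewrite addnS {1}/s big_ord_recr /= addrAC.
  apply: le_trans (lnormD N _ _) _.
  apply: le_trans (lerD IH (hu _)) _.
  by rewrite exprS; lra.
have sC : cauchy (s @ \oo).
  apply: cauchy_exP => e e0.
  have h : (fun n => 2 * 2^-1 ^+ n : R) @ \oo --> (0 : R).
    rewrite -[X in _ --> X](mulr0 (2:R)); apply: cvgMr.
    by apply: cvg_expr; rewrite gtr0_norm ?invf_lt1 ?ltr1n.
  have /cvgrPdist_lt/(_ e e0)[M _ hM] := h.
  exists (s M); exists M => // n /= Mn.
  rewrite /= -ball_normE /ball_ /= distrC.
  have := tail M (n - M)%N; rewrite subnKC // => hs.
  apply: le_lt_trans hs _.
  have := hM M (leqnn M); rewrite sub0r normrN ger0_norm; last first.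
    by rewrite mulr_ge0 // exprn_ge0 // invr_ge0.
  apply: le_lt_trans; rewrite gerBl mulr_ge0 // exprn_ge0 //.
by exists (lim (s @ \oo)); apply: hB.
Qed.

(** If [phi] were unbounded there would be [u n >= 0] of norm at most [2^-n]
    with [phi (u n) = 1].  Then [l = \sum u n] would dominate every partial
    sum, so that [phi l >= n] for all [n]. *)
Lemma positive_functional_bounded (R : realType) (E : rieszType R)
  (N : latticeNorm E) (phi : {scalar E}) :
  banach_lattice N -> (forall x, 0 <= x -> 0 <= phi x) ->
  exists2 c : R, 0 < c & forall x, 0 <= x -> c * phi x <= N x.
Proof.
move=> hB phi0; apply: contrapT => hno.
have /choice[u hu] : forall n, exists u : E,
    [/\ 0 <= u, N u <= 2^-1 ^+ n & phi u = 1].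
  move=> n; apply: contrapT => hn; apply: hno.
  exists (2^-1 ^+ n); first by rewrite exprn_gt0 // invr_gt0.
  move=> x x0; rewrite leNgt; apply/negP => hx; apply: hn.
  have px : 0 < phi x.
    have := le_lt_trans (lnorm_ge0 N x) hx.
    by rewrite pmulr_rgt0 // exprn_gt0 // invr_gt0.
  exists ((phi x)^-1 *: x); split.
  - by rewrite rscale_ge0 // invr_ge0 ltW.
  - rewrite lnormZ gtr0_norm ?invr_gt0 //.
    by rewrite mulrC ler_pdivrMr // ltW.
  - by rewrite linearZ /= mulVf // gt_eqF.
have [l sl] := banach_lattice_series hB (fun n => let: And3 _ h _ := hu n in h).
have smono i j : (i <= j)%N -> \sum_(k < i) u k <= \sum_(k < j) u k :> E.
  elim: j => [|j IH]; first by rewrite leqn0 => /eqP ->.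
  rewrite leq_eqVlt => /predU1P[-> //|/IH h].
  rewrite big_ord_recr /= -[leLHS]addr0.
  by apply: rleD => //; case: (hu j).
have phil n : n%:R <= phi l.
  have h := cvg_nondecreasing_le n smono sl.
  have := phi0 _ (etrans (rsub_ge0 _ _) h).
  rewrite linearB /= subr_ge0 linear_sum /=.
  rewrite (eq_bigr (fun=> 1)); last by move=> i _; case: (hu i).
  by rewrite sumr_const card_ord.
have := phil (Num.Def.truncn (phi l)).+1.
by apply/negP; rewrite -ltNge truncnS_gt.
Qed.

Section Unitization.
Variables (R : realType) (E : rieszType R) (tau : truncation E).
Implicit Types (u : unitization tau) (t : E).

(** A constant of its own, so that it can carry the structure of a linear
    functional on the unitization rather than on the product. *)
Definition scalar_part u : R := u.2.

Lemma scalar_part_is_linear : scalar scalar_part.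
Proof. by []. Qed.

HB.instance Definition _ :=
  GRing.isLinear.Build R (unitization tau) R *%R scalar_part
    scalar_part_is_linear.

Lemma scalar_part_ge0 u : 0 <= u -> 0 <= scalar_part u.
Proof. by rewrite unitization_ge0 => /uconeP[]. Qed.

Lemma uembed_ge0 t : 0 <= t -> 0 <= uembed tau t.
Proof. by rewrite unitization_ge0 /ucone /= eqxx => ->. Qed.

Lemma uembed_le_one t : t \in tfixed tau -> uembed tau t <= uone tau.
Proof.
move=> ht; have t0 : 0 <= t by case/andP: ht.
rewrite -rsub_ge0 unitization_ge0 uconeE /level.
rewrite [(uone tau - _).2](_ : _ = 1); last exact: subr0.
rewrite [(uone tau - _).1](_ : _ = - t); last exact: sub0r.
by rewrite oner_eq0 ler01 invr1 scale1r /rneg opprK (join_idPl t0).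
Qed.

(** The part of [t] above the level 1/2 is disjoint from [(1 - 2 t)^+], whose
    scalar part is 1 and which therefore uses up at least [c] of the norm of
    the unit. *)
Lemma AL_norm_tfixed_le (U : latticeNorm (unitization tau)) (c : R) t :
  AL_space U -> U (uone tau) = 1 ->
  (forall u, 0 <= u -> c * scalar_part u <= U u) ->
  t \in tfixed tau -> U (uembed tau t) <= 1 - c / 2.
Proof.
move=> [_ hd] U1 hc ht.
have t0 : 0 <= t by case/andP: ht.
set T := uembed tau t; set I := uone tau.
have T0 : 0 <= T := uembed_ge0 t0.
have TI : T <= I := uembed_le_one ht.
pose w := I - (T + T); pose q := rneg w; pose p := w + q.
have q0 : 0 <= q := rneg_ge0 w.
have p0 : 0 <= p := raddr_rneg_ge0 w.
(* - w = 2 T - 1 <= T because T <= 1. *)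
have qT : q <= T.
  by rewrite rneg_leP // /w opprD addrA subrK rsub_ge0.
have sq : scalar_part q = 0.
  apply: le_anti; rewrite scalar_part_ge0 // andbT.
  have := scalar_part_ge0 (etrans (rsub_ge0 _ _) qT).
  by rewrite linearB /= subr_ge0.
have sp : scalar_part p = 1.
  rewrite [scalar_part p](_ : _ = 1 - (0 + 0) + scalar_part q) //.
  by rewrite sq !addr0 subr0.
have Up : c <= U p by have := hc _ p0; rewrite sp mulr1.
have pqI : q + p <= I.
  rewrite /p addrCA /w -addrA -[leRHS]addr0 rleD2l addrC rleBlDr add0r.
  exact: rleD.
(* T + T = 1 - w, and - w <= w^- = q. *)
have TT : T + T <= I + q.
  have : - w <= q by exact: leUl.
  by rewrite opprB rleBlDr [q + I]addrC.
have qp : U q + U p <= 1.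
  rewrite -hd; last exact: rneg_disj.
  by rewrite -U1; apply: lnorm_le => //; apply: raddr_ge0.
have UTT : 2 * U T <= 1 + U q.
  have -> : 2 * U T = U (T + T).
    have <- : (2 : R) *: T = T + T by rewrite scaler_nat.
    by rewrite lnormZ normr_nat.
  apply: le_trans (_ : U (I + q) <= _); first by rewrite lnorm_le ?raddr_ge0.
  by rewrite -U1; apply: lnormD.
by lra.
Qed.
End Unitization.

Theorem corollary3p6 (R : realType) (E : rieszType R) (N : latticeNorm E)
  (tau : truncation E) (hE : truncated_normed N tau)
  (U : latticeNorm (unitization tau)) (hU : truncation_unitization_norm N U) :
  ~ AL_space U.
Proof.
move=> hAL; case: hE => _ hsup; case: hU => U1 UE.
have [c c0 hc] := positive_functional_bounded (phi := @scalar_part R E tau)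
  hAL.1 (@scalar_part_ge0 R E tau).
suff : sup [set N (tau f) | f in [set f : E | 0 <= f]] <= 1 - c / 2.
  by rewrite hsup; lra.
apply: ge_sup; first by exists (N (tau 0)); exists 0 => //=; exact: lexx.
move=> _ [f /= f0 <-]; rewrite -UE.
exact: AL_norm_tfixed_le hAL U1 hc (trunc_tfixed tau f0).
Qed.
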